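(* Let $p\ge1$ be an integer. The $p$-star $G_1(p)$ satisfies $$M(G_1(p);x)=1+\sum_{k\ge2}\binom pk x^{\binom k2}.$$ In particular, $M(G_1(p))=2^p-p$. Moreover, the corresponding class sizes are $$s_1(G_1(p))=2^p-p-1\qquad\text{and}\qquad s_{p+1}(G_1(p))=1.$$
   Context: A DAG with skeleton $G$ (a finite simple undirected graph) is an acyclic orientation of all edges of $G$. An immorality in a DAG is an induced subgraph $i\to j\leftarrow k$ (so $i,k$ are nonadjacent). Two DAGs are Markov equivalent iff they have the same skeleton and the same set of immoralities; a Markov equivalence class (MEC) with skeleton $G$ is an equivalence class of DAGs with skeleton $G$; all its members have the same immoralities, and its size is the number of DAGs in it. Let $m_k(G)$ be the number of MECs with skeleton $G$ having exactly $k$ immoralities, $M(G;x)=\sum_{k\ge0}m_k(G)x^k$, $M(G)=M(G;1)$ the total number of MECs with skeleton $G$, and $s_k(G)$ the number of MECs with skeleton $G$ of size $k$. The $p$-star $G_1(p)$ is the tree with $p+1$ vertices consisting of a center vertex joined to $p$ leaves. *)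

(* Defs.v *)
From mathcomp Require Import all_boot all_order all_algebra.

Set Implicit Arguments.
Unset Strict Implicit.
Unset Printing Implicit Defensive.

Import Order.TTheory GRing.Theory Num.Theory.

Record sgraph := SGraph {
  vertex :> finType;
  edge : rel vertex;
  edge_sym : symmetric edge;
  edge_irrefl : irreflexive edge }.

Section Digraphs.
Variable V : finType.

(* A directed graph on V is given by its set of arcs: (i, j) \in D is i -> j. *)
Definition digraph := {set V * V}.
Implicit Types D E : digraph.

Definition arc D : rel V := [rel i j | (i, j) \in D].

Definition skeleton D : rel V := [rel i j | arc D i j || arc D j i].

(* No arc x -> y is closed by a directed path from y back to x; this also
   excludes loops and pairs of opposite arcs. *)
Definition acyclic D :=
  [forall x, forall y, arc D x y ==> ~~ connect (arc D) y x].

(* i -> j <- k and k -> j <- i are the same immorality, stored once, as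
   ([set i; k], j). *)
Definition immoralities D : {set {set V} * V} :=
  [set t | [exists i, exists k,
     [&& t.1 == [set i; k], i != k, arc D i t.2, arc D k t.2
       & ~~ skeleton D i k]]].

Definition markov_equiv D E :=
  [forall i, forall j, skeleton D i j == skeleton E i j]
  && (immoralities D == immoralities E).

End Digraphs.

Section MECs.
Variable G : sgraph.

Definition dags : {set digraph G} :=
  [set D | acyclic D && [forall i, forall j, skeleton D i j == edge i j]].

Definition MECs : {set {set digraph G}} :=
  equivalence_partition (@markov_equiv G) dags.

(* The members of a class share their immoralities, so "some" may equally well
   be read as "every" here. *)
Definition has_immoralities (C : {set digraph G}) (k : nat) :=
  [exists D in C, #|immoralities D| == k].

Definition m (k : nat) : nat := #|[set C in MECs | has_immoralities C k]|.

Definition s (k : nat) : nat := #|[set C in MECs | #|C| == k]|.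

(* The cut-off is the number of conceivable immoralities, beyond which m
   vanishes; see coef_Mpoly. *)
Definition Mpoly : {poly int} :=
  (\poly_(k < #|{: {set G} * G}|.+1) (m k)%:R)%R.

Definition M : int := Mpoly.[1]%R.

Lemma m_eq0 k : #|{: {set G} * G}| < k -> m k = 0.
Proof.
move=> ltk; apply/eqP; rewrite cards_eq0; apply/eqP/setP=> C; rewrite !inE.
apply/negP=> /andP[_ /exists_inP[D _ /eqP Dk]].
by move: (max_card (mem (immoralities D))); rewrite Dk leqNgt ltk.
Qed.

Lemma coef_Mpoly k : (Mpoly`_k = (m k)%:R)%R.
Proof. by rewrite coef_poly ltnS; case: leqP => // /m_eq0 ->. Qed.

Lemma markov_equiv_equivalence :
  {in dags & &, equivalence_rel (@markov_equiv G)}.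
Proof.
move=> D E F _ _ _; split=> [|/andP[/'forall_'forall_eqP sDE /eqP iDE]].
  by rewrite /markov_equiv eqxx andbT; apply/'forall_'forall_eqP.
rewrite /markov_equiv iDE; congr (_ && _).
by apply: eq_forallb => i; apply: eq_forallb => j; rewrite sDE.
Qed.

Lemma M_card : (M = #|MECs|%:R)%R.
Proof.
have [_ _ n0] := and3P (equivalence_partitionP markov_equiv_equivalence).
rewrite /M /Mpoly horner_poly.
under eq_bigr do rewrite expr1n mulr1.
rewrite -natr_sum; congr (_%:R)%R; rewrite /m /has_immoralities.
under eq_bigr do rewrite -sum1dep_card big_mkcondr /=.
rewrite exchange_big -sum1_card; apply: eq_bigr => C CM /=.
have [D DC] : exists D, D \in C.
  by apply/set0Pn; apply: contraNneq n0 => <-.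
have imC E : E \in C -> immoralities E = immoralities D.
  move: CM DC => /imsetP[x _ ->]; rewrite !inE.
  by move=> /and3P[_ _ /eqP <-] /and3P[_ _ /eqP <-].
have lt : #|immoralities D| < #|{: {set G} * G}|.+1 by rewrite ltnS max_card.
rewrite (bigD1 (Ordinal lt)) //= [X in (X + _)%N]ifT; last first.
  by apply/exists_inP; exists D.
rewrite big1 // => k /eqP nk; rewrite ifF //; apply: negbTE; apply/negP.
move=> /exists_inP[E /imC EC /eqP kE]; apply: nk; apply: val_inj.
by rewrite /= -kE EC.
Qed.

End MECs.

Definition star_rel (p : nat) : rel 'I_p.+1 :=
  [rel i j | (i == ord0) != (j == ord0)].

Lemma star_sym p : symmetric (@star_rel p).
Proof. by move=> i j; exact: (congr1 negb (eq_sym _ _)). Qed.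

Lemma star_irrefl p : irreflexive (@star_rel p).
Proof. by move=> i; exact: (congr1 negb (eqxx _)). Qed.

(* The center is ord0; the leaves are the p other elements of 'I_p.+1. *)
Definition star (p : nat) : sgraph := SGraph (@star_sym p) (@star_irrefl p).

(* Main.v *)
Require Import Defs.
From mathcomp Require Import all_boot all_order all_algebra.
Import Order.TTheory GRing.Theory Num.Theory.
Local Open Scope ring_scope.

(** A DAG on the star is determined by the set A of leaves whose edge points
    to the center, and every set of leaves occurs, since an oriented tree has
    no directed cycle.  Two leaves are never adjacent, so the immoralities are
    exactly the pairs of elements of A, all of them with the center as common
    child ([immoralities_star_dag]); there are 'C(#|A|, 2) of them.

    A set with at least two elements is the union of its pairs, whereas all
    the sets with at most one element have the same (empty) set of pairs
    ([eq_pairsE]).  Hence each A with #|A| >= 2 gives a Markov equivalence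
    class of its own, a singleton, and the remaining 1 + p sets A together
    form the class without immoralities ([star_MECs]).  All four claims are
    then counts of classes, and [card_star_MECs] turns each of them into a sum
    over the sets of at least two leaves, which is grouped by cardinality. *)

(** * Pairs in a finite set and sums over its subsets *)

Definition pairs {T : finType} (A : {set T}) : {set {set T}} :=
  [set B : {set T} | B \subset A & #|B| == 2].

Lemma pairs2 {T : finType} (A : {set T}) {x y : T} :
  x != y -> ([set x; y] \in pairs A) = (x \in A) && (y \in A).
Proof. by move=> xy; rewrite inE cards2 xy andbT subUset !sub1set. Qed.

(** A set with a second element besides [x] has a pair through [x], so its
    pairs cover it. *)
Lemma pairs_sub {T : finType} {A B : {set T}} :
  (1 < #|A|)%N -> pairs A = pairs B -> A \subset B.
Proof.
move=> A2 eqAB; apply/subsetP=> x xA.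
move: A2; rewrite (cardsD1 x) xA ltnS card_gt0 => /set0Pn[y].
rewrite !inE eq_sym => /andP[xy yA].
have /andP[] // : (x \in B) && (y \in B).
by rewrite -pairs2 // -eqAB pairs2 // xA.
Qed.

Lemma eq_pairsE (T : finType) (A B : {set T}) :
  (pairs A == pairs B) = (A == B) || (#|A| <= 1)%N && (#|B| <= 1)%N.
Proof.
apply/eqP/orP=> [eqAB | [/eqP -> // | /andP[A1 B1]]]; last first.
  have pairs0 (C : {set T}) : (#|C| <= 1)%N -> pairs C = set0.
    by move=> C1; apply/eqP; rewrite -cards_eq0 cards_draws bin_small.
  by rewrite !pairs0.
have [A1 | A2] := leqP #|A| 1; have [B1 | B2] := leqP #|B| 1.
- by right.
- have BA := pairs_sub B2 (esym eqAB).
  by have := leq_trans B2 (leq_trans (subset_leq_card BA) A1).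
- have AB := pairs_sub A2 eqAB.
  by have := leq_trans A2 (leq_trans (subset_leq_card AB) B1).
- by left; rewrite eqEsubset !pairs_sub.
Qed.

Lemma sum_powerset_card (T : finType) (L : {set T}) (a : nat) (F : nat -> nat) :
  (\sum_(A in powerset L | a <= #|A|) F #|A|
     = \sum_(a <= k < #|L|.+1) 'C(#|L|, k) * F k)%N.
Proof.
rewrite big_geq_mkord.
rewrite (partition_big (fun A : {set T} => inord #|A| : 'I_#|L|.+1)
  (fun k => a <= k)%N) /=; last first.
  move=> A /andP[]; rewrite powersetE => AL aA.
  by rewrite inordK // ltnS subset_leq_card.
apply: eq_bigr => k ak; rewrite -cards_draws -sum_nat_const.
apply: eq_big => [A | A /andP[/andP[]]]; last first.
  by rewrite powersetE => AL _ /eqP <-; rewrite inordK // ltnS subset_leq_card.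
rewrite !inE -andbA; case AL: (A \subset L) => //=.
rewrite -(inj_eq val_inj) /= inordK ?ltnS ?subset_leq_card //.
by case: eqVneq => [-> | _]; rewrite ?ak ?andbF.
Qed.

(** * The acyclic orientations of a star *)

(** The rank increases along directed paths, so none returns to its start. *)
Lemma rank_acyclic {V : finType} {D : digraph V} (r : V -> nat) :
  (forall x y, Defs.arc D x y -> (r x < r y)%N) -> acyclic D.
Proof.
move=> rD; apply/'forall_'forall_implyP=> x y /rD rxy.
apply: contraL rxy => /connectP[q Dq ->]; rewrite -leqNgt.
elim: q y Dq => //= z q IHq y /andP[/rD ryz /IHq].
exact: leq_trans (ltnW ryz).
Qed.

Section Star.

(** Besides the size only the adjacency in terms of the center [c] matters, so
    the star is kept abstract instead of being realized on ['I_p.+1]. *)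
Context {G : sgraph} (c : G) {p : nat}.
Context (starG : forall i j : G, edge i j = ((i == c) != (j == c))).
Context (cardG : #|G| = p.+1) (p_gt0 : (0 < p)%N).

Definition leaves : {set G} := [set~ c].

Lemma card_leaves : #|leaves| = p.
Proof. by rewrite cardsC1 cardG. Qed.

(** [A] is the set of the leaves whose edge points to the center. *)
Definition star_dag (A : {set G}) : digraph G :=
  [set a : G * G | if a.2 == c then a.1 \in A
                     else (a.1 == c) && (a.2 \notin A)].

Lemma in_star_dag (A : {set G}) (i j : G) :
  ((i, j) \in star_dag A) = if j == c then i \in A
                            else (i == c) && (j \notin A).
Proof. by rewrite in_set. Qed.

Lemma star_dag_inj : injective star_dag.
Proof.
move=> A B eqAB; apply/setP=> i.
by move/setP/(_ (i, c)): eqAB; rewrite !in_star_dag eqxx.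
Qed.

Lemma center_notin {A : {set G}} :
  A \subset leaves -> (c \in A) = false.
Proof.
by move=> /subsetP AL; apply/negP=> /AL; rewrite !inE eqxx.
Qed.

Lemma skeleton_star_dag {A : {set G}} (i j : G) :
  A \subset leaves -> skeleton (star_dag A) i j = edge i j.
Proof.
move=> AL; have A0 := center_notin AL.
rewrite /skeleton /Defs.arc /= !in_star_dag starG.
case: (eqVneq i c) => [->|_]; case: (eqVneq j c) => [jc|_];
  by rewrite ?jc ?A0 ?orbF ?orNb ?orbN.
Qed.

Lemma star_dag_acyclic {A : {set G}} :
  A \subset leaves -> acyclic (star_dag A).
Proof.
move=> AL; have A0 := center_notin AL.
(* every directed path leads from [A] to the center, then to the other leaves *)
pose r (i : G) :=
  if i \in A then 0%N else if i == c then 1%N else 2%N.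
apply: (rank_acyclic r) => i j; rewrite /Defs.arc /= in_star_dag /r.
case: (eqVneq j c) => [-> -> | j0 /andP[/eqP -> /negbTE ->]].
  by rewrite A0.
by rewrite A0 eqxx.
Qed.

(** In a DAG the edge from the center to a leaf carries exactly one of its two
    possible arcs, so the parents of the center determine the DAG. *)
Lemma star_dagsE :
  dags G = [set star_dag A | A in powerset leaves].
Proof.
apply/setP=> D; rewrite inE.
apply/andP/imsetP=> [[Dac Dsk] | [A AL ->]]; last first.
  rewrite powersetE in AL; split; first exact: star_dag_acyclic.
  by apply/'forall_'forall_eqP=> i j; exact: skeleton_star_dag.
have Dasym i j : Defs.arc D i j -> ~~ Defs.arc D j i.
  move=> Dij; move/'forall_'forall_implyP/(_ i j Dij): Dac.
  by apply: contra => /connect1.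
have {}Dsk i j : Defs.arc D i j || Defs.arc D j i = ((i == c) != (j == c)).
  by move/'forall_'forall_eqP/(_ i j): Dsk; rewrite starG.
exists [set i | Defs.arc D i c].
  rewrite powersetE; apply/subsetP=> i; rewrite !inE => Di0.
  by have := Dsk i c; rewrite Di0 eqxx; case: (i == c).
apply/setP=> -[i j]; rewrite in_star_dag.
case: (eqVneq j c) => [-> | j0]; first by rewrite inE.
rewrite inE; have := Dsk i j; have := Dasym c j.
rewrite /Defs.arc /= (negbTE j0).
case: (eqVneq i c) => [-> | _] /= => [asym | _]; last by case: ((i, j) \in D).
by case: ((c, j) \in D) asym => [/(_ isT) /negbTE -> | _ /= ->].
Qed.

(** * The Markov equivalence classes of a star *)

(** Only the center can have two parents, and any two of its parents form an
    immorality because leaves are pairwise nonadjacent. *)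
Lemma immoralities_star_dag {A : {set G}} :
  A \subset leaves ->
  immoralities (star_dag A) = [set (B, c) | B in pairs A].
Proof.
move=> AL; have A0 := center_notin AL.
apply/setP=> -[B j]; rewrite inE.
apply/existsP/imsetP=> [[i /existsP[k]] | [B' BA [-> ->]]].
  move=> /and5P[/eqP/= -> ik + + _].
  rewrite /Defs.arc /= !in_star_dag.
  case: (eqVneq j c) => [-> iA kA | _ /andP[/eqP i0 _] /andP[/eqP k0 _]].
    by exists [set i; k]; rewrite ?pairs2 ?iA.
  by rewrite i0 k0 eqxx in ik.
rewrite inE in BA; case/andP: BA => BA /cards2P[i [k [ik eqB]]].
rewrite eqB subUset !sub1set in BA *; case/andP: BA => iA kA.
exists i; apply/existsP; exists k.
rewrite skeleton_star_dag // starG /Defs.arc /= !in_star_dag !eqxx ik iA kA /=.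
have nc x : x \in A -> (x == c) = false.
  by move=> xA; apply: contraTF xA => /eqP ->; rewrite A0.
by rewrite !nc.
Qed.

Lemma card_immoralities_star_dag {A : {set G}} :
  A \subset leaves -> #|immoralities (star_dag A)| = 'C(#|A|, 2).
Proof.
move=> AL; rewrite immoralities_star_dag // card_imset ?cards_draws //.
by move=> B C [].
Qed.

Lemma markov_equiv_star_dag {A B : {set G}} :
  A \subset leaves -> B \subset leaves ->
  markov_equiv (star_dag A) (star_dag B)
    = (A == B) || (#|A| <= 1)%N && (#|B| <= 1)%N.
Proof.
move=> AL BL; rewrite -eq_pairsE /markov_equiv !immoralities_star_dag //.
have -> : [forall i, forall j,
             skeleton (star_dag A) i j == skeleton (star_dag B) i j].
  by apply/'forall_'forall_eqP=> i j; rewrite !skeleton_star_dag.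
by rewrite (inj_eq (imset_inj _)) // => C D [].
Qed.

Definition small_leaf_sets : {set {set G}} :=
  [set A in powerset leaves | (#|A| <= 1)%N].

Definition large_leaf_sets : {set {set G}} :=
  [set A in powerset leaves | (1 < #|A|)%N].

Definition no_immorality_class : {set digraph G} :=
  [set star_dag A | A in small_leaf_sets].

(** By [markov_equiv_star_dag] two distinct sets of leaves are equivalent only
    if both are small. *)
Lemma star_MECs :
  MECs G = no_immorality_class
           |: [set [set star_dag A] | A in large_leaf_sets].
Proof.
pose cls (A : {set G}) :=
  [set E in dags G | markov_equiv (star_dag A) E].
have clsE A : A \in powerset leaves ->
    cls A = if (#|A| <= 1)%N then no_immorality_class else [set star_dag A].
  rewrite powersetE => AL; apply/setP=> E; rewrite inE star_dagsE.
  apply/andP/idP=> [[/imsetP[B BL ->]] | ].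
    move: (BL); rewrite powersetE => BL'; rewrite markov_equiv_star_dag //.
    have [A1 | A2] := leqP #|A| 1; last by rewrite orbF inE eq_sym => /eqP ->.
    move=> AB; apply: imset_f; rewrite inE BL /=.
    by case/orP: AB => [/eqP <- |].
  have [A1 | A2] := leqP #|A| 1; last first.
    rewrite inE => /eqP ->; rewrite imset_f ?powersetE //.
    by rewrite markov_equiv_star_dag // eqxx.
  case/imsetP=> B; rewrite inE => /andP[BL B1] ->; rewrite imset_f //.
  by rewrite powersetE in BL; rewrite markov_equiv_star_dag // A1 B1 orbT.
apply/setP=> C; rewrite in_setU1.
apply/imsetP/orP=> [[D] | [/eqP -> | /imsetP[A]]].
- move=> DG; rewrite star_dagsE in DG; case/imsetP: DG => A AL -> ->.
  rewrite -/(cls A) clsE //.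
  have [A1 | A2] := leqP #|A| 1; [by left | right].
  by apply: imset_f; rewrite inE AL.
- exists (star_dag set0).
    by rewrite star_dagsE imset_f ?powersetE ?sub0set.
  by rewrite -[RHS]/(cls set0) clsE ?cards0 // powersetE sub0set.
- rewrite inE => /andP[AL A2] ->; exists (star_dag A).
    by rewrite star_dagsE imset_f.
  by rewrite -[RHS]/(cls A) clsE // leqNgt A2.
Qed.

(** * Counting the classes *)

Lemma sum_large_leaf_sets (F : nat -> nat) :
  (\sum_(A in large_leaf_sets) F #|A| = \sum_(2 <= k < p.+1) 'C(p, k) * F k)%N.
Proof.
rewrite -card_leaves -sum_powerset_card.
by apply: eq_bigl => A; rewrite inE.
Qed.

Lemma card_large_leaf_sets : (#|large_leaf_sets| + p.+1 = 2 ^ p)%N.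
Proof.
have := sum_powerset_card G leaves 0 (fun=> 1%N).
rewrite card_leaves big_ltn // big_ltn // -(sum_large_leaf_sets (fun=> 1%N)).
rewrite bin0 bin1 !muln1 addnA add1n addnC -sum1_card => <-.
rewrite -card_leaves -card_powerset -sum1_card.
by apply: eq_bigl => A; rewrite andbT.
Qed.

(** This class has a member for every leaf set with at most one element: 2 ^ p
    leaf sets in all, without the large ones. *)
Lemma card_no_immorality_class : #|no_immorality_class| = p.+1.
Proof.
rewrite card_imset; last exact: star_dag_inj.
have := cardsID [set A : {set G} | 1 < #|A|]%N (powerset leaves).
rewrite card_powerset card_leaves -card_large_leaf_sets -setIdE => /addnI <-.
by congr #|pred_of_set _|; apply/setP=> A; rewrite !inE -leqNgt andbC.
Qed.

(** The singleton classes are distinct from the class without immoralities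
    because that one has [p.+1 >= 2] members. *)
Lemma card_star_MECs (Q : pred {set digraph G}) :
  (#|[set C in MECs G | Q C]|
     = Q no_immorality_class
       + \sum_(A in large_leaf_sets) Q [set star_dag A])%N.
Proof.
rewrite -sum1dep_card big_mkcondr /= star_MECs big_setU1 /=; last first.
  apply/imsetP=> -[A _ eqE]; have := card_no_immorality_class.
  by rewrite eqE cards1 => -[p1]; move: p_gt0; rewrite -p1.
by rewrite big_imset //= => A B _ _ /set1_inj /star_dag_inj.
Qed.

Lemma star_m (k : nat) :
  m G k = ((k == 0) + \sum_(2 <= j < p.+1) 'C(p, j) * (k == 'C(j, 2)))%N.
Proof.
rewrite /m card_star_MECs.
have -> : has_immoralities no_immorality_class k = (k == 0%N).
  apply/exists_inP/eqP=> [[D /imsetP[A]] | ->].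
    rewrite inE powersetE => /andP[AL A1] -> /eqP <-.
    by rewrite card_immoralities_star_dag // bin_small.
  exists (star_dag set0).
    by rewrite imset_f // inE powersetE sub0set cards0.
  by rewrite card_immoralities_star_dag ?sub0set // cards0.
rewrite -(sum_large_leaf_sets (fun j => k == 'C(j, 2) : nat)); congr (_ + _)%N.
apply: eq_bigr => A; rewrite inE powersetE => /andP[AL _]; congr nat_of_bool.
rewrite -(card_immoralities_star_dag AL) eq_sym.
apply/exists_inP/idP=> [[D] | Ak]; first by rewrite inE => /eqP ->.
by exists (star_dag A); rewrite ?inE.
Qed.

Lemma card_MECs_star : (#|MECs G| = 1 + #|large_leaf_sets|)%N.
Proof.
have -> : MECs G = [set C in MECs G | predT C].
  by apply/setP=> C; rewrite inE andbT.
by rewrite card_star_MECs /= sum1_card.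
Qed.

Lemma star_singleton_MECs : s G 1 = #|large_leaf_sets|.
Proof.
rewrite /s card_star_MECs card_no_immorality_class eqSS eqn0Ngt p_gt0 add0n.
by rewrite -sum1_card; apply: eq_bigr => A _; rewrite cards1.
Qed.

Lemma star_MECs_of_size_p1 : s G p.+1 = 1%N.
Proof.
rewrite /s card_star_MECs card_no_immorality_class eqxx.
by rewrite big1 // => A _; rewrite cards1 eqSS eq_sym eqn0Ngt p_gt0.
Qed.

End Star.

Theorem theorem2p4 (p : nat) (hp : (1 <= p)%N) :
  [/\ Mpoly (star p) =
        1 + \sum_(2 <= k < p.+1) 'C(p, k)%:R *: 'X^('C(k, 2)),
      M (star p) = 2%:R ^+ p - p%:R,
      (s (star p) 1)%:R = 2%:R ^+ p - p%:R - 1 :> int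
    & s (star p) p.+1 = 1%N].
Proof.
pose c : star p := (ord0 : 'I_p.+1).
have starG (i j : star p) : edge i j = ((i == c) != (j == c)) by [].
have cardG : #|star p| = p.+1 by exact: card_ord.
have largeE : #|large_leaf_sets c|%:R = 2%:R ^+ p - p%:R - 1 :> int.
  rewrite -natrX -(card_large_leaf_sets c cardG hp) -add1n.
  by rewrite !natrD addrA !addrK.
split.
- apply/polyP=> k; rewrite coef_Mpoly (star_m c starG cardG hp) coefD coef1.
  rewrite coef_sum natrD natr_sum; congr (_ + _).
  by apply: eq_bigr => j _; rewrite natrM coefZ coefXn.
- by rewrite M_card (card_MECs_star c starG cardG hp) natrD largeE addrC subrK.
- by rewrite (star_singleton_MECs c starG cardG hp).
- exact: (star_MECs_of_size_p1 c starG cardG hp).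
Qed.
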